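(* Let $E$ be a set and, for $i\in\{0,1\}$, let $M_i$ be a finitary matroid on $E$ and let $I_i\in\mathcal{I}_{M_0}\cap\mathcal{I}_{M_1}$. Then there is an $I\in\mathcal{I}_{M_0}\cap\mathcal{I}_{M_1}$ with $I_i\subseteq\mathsf{span}_{M_i}(I)$ for $i\in\{0,1\}$.
   Context: Matroids may be infinite: a matroid $M=(E,\mathcal{I}_M)$ on a (possibly infinite) set $E$ is a family $\mathcal{I}_M\subseteq\mathcal{P}(E)$ of ''independent'' sets such that (I) $\varnothing\in\mathcal{I}_M$; (II) $\mathcal{I}_M$ is downward closed; (III) for all $I,J\in\mathcal{I}_M$ with $J$ $\subseteq$-maximal in $\mathcal{I}_M$ and $I$ not, there is $e\in J\setminus I$ with $I+e\in\mathcal{I}_M$; (IV) for every $X\subseteq E$, every $I\in\mathcal{I}_M\cap\mathcal{P}(X)$ extends to a $\subseteq$-maximal element of $\mathcal{I}_M\cap\mathcal{P}(X)$. Circuits are minimal dependent sets. A matroid is finitary if all its circuits are finite. For $X\subseteq E$, $\mathsf{span}_M(X)$ is the set of $e\in E$ such that $e\in X$ or there is a circuit $C\ni e$ of $M$ with $C-e\subseteq X$. *)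

(* Defs.v *)
From mathcomp Require Import all_boot.
From mathcomp Require Import boolp classical_sets functions cardinality.

Set Implicit Arguments.
Unset Strict Implicit.
Unset Printing Implicit Defensive.

Local Open Scope classical_set_scope.

Definition inclusion_maximal (E : Type) (F : set (set E)) (X : set E) : Prop :=
  F X /\ forall Y, F Y -> X `<=` Y -> Y = X.

Definition inclusion_minimal (E : Type) (F : set (set E)) (X : set E) : Prop :=
  F X /\ forall Y, F Y -> Y `<=` X -> Y = X.

(* Possibly infinite matroids; the ground set is the whole type [E]. *)
Record matroid (E : Type) : Type := Matroid {
  indep : set (set E);
  indep_set0 : indep set0;
  indep_sub : forall I J, indep J -> I `<=` J -> indep I;
  indep_augment : forall I J, indep I ->
    ~ inclusion_maximal indep I -> inclusion_maximal indep J ->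
    exists2 e, (J `\` I) e & indep (I `|` [set e]);
  indep_extend : forall X I, indep I -> I `<=` X ->
    exists2 B, inclusion_maximal [set K | indep K /\ K `<=` X] B & I `<=` B
}.

Definition circuit (E : Type) (M : matroid E) (C : set E) : Prop :=
  inclusion_minimal (~` indep M) C.

Definition finitary (E : Type) (M : matroid E) : Prop :=
  forall C, circuit M C -> finite_set C.

Definition mspan (E : Type) (M : matroid E) (X : set E) : set E :=
  [set e | X e \/ exists C, [/\ circuit M C, C e & C `\ e `<=` X]].

(* Main.v *)
Require Import Defs.
From mathcomp Require Import all_boot.
From mathcomp Require Import boolp classical_sets functions cardinality.
From mathcomp Require wochoice.

Set Implicit Arguments.
Unset Strict Implicit.
Unset Printing Implicit Defensive.

Local Open Scope classical_set_scope.

(** Well-order the ground set and let a matroid [M] reject from a set [X] the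
elements spanned in [M] by their predecessors in [X]. Rejection is monotone in
[X], and the accepted elements form an independent set spanning [X]. For [M0]
take a well-order starting with [I1], and for [M1] one starting with [I0]. As in
Fleiner's approach to stable matchings, Tarski's fixed point theorem gives [A]
and [B] such that [B] is the complement of what [M0] rejects from [A] and [A] is
the complement of what [M1] rejects from [B]. Then [I := A `&` B] is what [M0]
accepts from [A] and also what [M1] accepts from [B]. No element of the
[M1]-independent initial segment [I0] can be rejected by [M1], so [I0] lies in
[A], which is spanned by [I] in [M0]; symmetrically for [I1]. *)

(** * Bases, circuits and span in infinite matroids *)

Section MatroidTheory.
Context {E : Type} (M : matroid E).
Implicit Types (I J X B C D : set E) (x e : E).

Local Notation basis X := (inclusion_maximal [set K | indep M K /\ K `<=` X]).

Lemma not_base_augment I x : ~ I x -> indep M (I `|` [set x]) ->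
  ~ inclusion_maximal (indep M) I.
Proof.
move=> nIx Ix [_ /(_ _ Ix (@subsetUl _ _ _)) eqI].
by apply: nIx; rewrite -eqI; right.
Qed.

Lemma basis_notin X B x : basis X B -> X x -> ~ B x -> ~ indep M (B `|` [set x]).
Proof.
move=> [[_ BX] Bmax] Xx nBx iBx; apply: nBx.
rewrite -(Bmax (B `|` [set x])) //; first by right.
by split=> // y [/BX//|->].
Qed.

Lemma basisI X B : indep M B -> B `<=` X ->
  (forall x, X x -> ~ B x -> ~ indep M (B `|` [set x])) -> basis X B.
Proof.
move=> iB BX Bmax; split=> // K [iK KX] BK; apply/seteqP; split=> // x Kx.
apply: contrapT => nBx; apply: (Bmax x (KX _ Kx) nBx).
by apply: indep_sub iK _ => y [/BK|->].
Qed.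

Lemma extend_base I : indep M I ->
  exists2 B, inclusion_maximal (indep M) B & I `<=` B.
Proof.
move=> iI; have [//|B [[iB _] Bmax] IB] := @indep_extend _ M setT I iI.
by exists B => //; split=> // K iK; apply: Bmax.
Qed.

(* [I] augmented from a base extending [J]: any augmenting element outside [X]
is already in [K]. *)
Lemma basis_extend_base X I J B K : J `<=` B -> basis X J ->
  inclusion_maximal (indep M) B ->
  (forall e, J e -> I e \/ ~ indep M (I `|` [set e])) ->
  I `<=` K -> basis (I `|` (B `\` X)) K -> inclusion_maximal (indep M) K.
Proof.
move=> JB bJ baseB noaug IK bK; have [[iK _] _] := bK.
apply: contrapT => nbK.
have [e [Be nKe] iKe] := indep_augment iK nbK baseB.
have [Xe|nXe] := pselect (X e); last by apply: (basis_notin bK) nKe iKe; right.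
have Je : J e.
  apply: contrapT => nJe; apply: (basis_notin bJ Xe nJe).
  by apply: indep_sub (baseB.1) _ => y [/JB|->].
case: (noaug e Je) => [/IK//|]; apply.
by apply: indep_sub iKe _ => y [/IK|->]; [left|right].
Qed.

(** Exchange inside [X] reduces to exchange between bases of [M]: if no element of [J] augments [I],
    two bases above [I], compared with a base [B] above [J], yield an element of [X] that augments
    [J]. *)
Lemma basis_augment X I J x : basis X J -> X x -> ~ I x ->
  I `<=` X -> indep M (I `|` [set x]) ->
  exists2 e, (J `\` I) e & indep M (I `|` [set e]).
Proof.
move=> bJ Xx nIx IX iIx; apply: contrapT => noaug.
have {}noaug e : J e -> I e \/ ~ indep M (I `|` [set e]).
  move=> Je; have [|nIe] := pselect (I e); [by left|right => iIe].
  by apply: noaug; exists e.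
have [[iJ JX] _] := bJ.
have [B baseB JB] := extend_base iJ.
have iI : indep M I by apply: indep_sub iIx _ => y; left.
have [K bK IK] := indep_extend iI (@subsetUl _ I (B `\` X)).
have baseK := basis_extend_base JB bJ baseB noaug IK bK.
have [[iK KIB] _] := bK.
have nKx : ~ K x by move=> /KIB[//|[_]].
have sIKx : I `|` [set x] `<=` K `|` [set x] by move=> y [/IK|]; [left|right].
have [K' bK' IK'] := indep_extend iIx sIKx.
have [[iK' K'Kx] _] := bK'.
have K'x : K' x by apply: IK'; right.
have baseK' : inclusion_maximal (indep M) K'.
  apply: contrapT => /(indep_augment iK')/(_ baseK)[e [Ke nK'e]].
  by apply: (basis_notin bK') nK'e; left.
(* [K'] contains [x], so it cannot contain the whole base [K]. The lost element [z] is not in [I],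
   hence lies in [B] outside [X]. *)
have [z Kz nK'z] : exists2 z, K z & ~ K' z.
  apply: contrapT => KK'; apply: (not_base_augment nKx _ baseK).
  apply: indep_sub iK' _ => y [Ky|->//].
  by apply: contrapT => nK'y; apply: KK'; exists y.
have [Bz nXz] : (B `\` X) z by case: (KIB z Kz) => // Iz; case: nK'z; apply: IK'; left.
have iBz : indep M (B `\ z) by apply: indep_sub baseB.1 _ => y [].
have nbBz : ~ inclusion_maximal (indep M) (B `\ z).
  have nBz : ~ (B `\ z) z by move=> [_ /(_ erefl)].
  apply: (not_base_augment nBz).
  by apply: indep_sub baseB.1 _ => y [[]|->].
(* As [e] is not in [B], it lies in [X]. Removing [z] leaves [J] intact, so [J] together with [e] is
   independent. *)
have [e [K'e nBze] iBze] := indep_augment iBz nbBz baseK'.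
have nez : e <> z by move=> ez; apply: nK'z; rewrite -ez.
have nBe : ~ B e by move=> Be; apply: nBze.
have Xe : X e.
  by case: (K'Kx e K'e) => [/KIB[/IX|[]]|->].
apply: (basis_notin bJ Xe) => [/JB//|].
apply: indep_sub iBze _ => y [Jy|->]; last by right.
by left; split; [apply: JB|move=> yz; apply: nXz; rewrite -yz; apply: JX].
Qed.

(** [C] consists of the elements whose removal from [B] plus [e] restores independence. Were [C]
    independent, a basis above it would miss some [x] in [B]; augmenting [B] minus [x] from that
    basis can only add [e], which puts [x] into [C]. *)
Lemma fundamental_circuit B e : indep M B -> ~ indep M (B `|` [set e]) ->
  exists C, [/\ circuit M C, C e & C `\ e `<=` B].
Proof.
move=> iB dBe; pose C := [set x | (B `|` [set e]) x /\ indep M ((B `|` [set e]) `\ x)].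
have nBe : ~ B e by move=> Be; apply: dBe; apply: indep_sub iB _ => y [|->].
have Ce : C e by split; [right|apply: indep_sub iB _ => y [[]]].
exists C; split=> //; last by move=> x [[[]]].
split=> [iC|D dD DC].
  have sCBe : C `<=` B `|` [set e] by move=> x [].
  have [J bJ CJ] := indep_extend iC sCBe.
  have [[iJ JBe] _] := bJ.
  have [x Bx nJx] : exists2 x, B x & ~ J x.
    apply: contrapT => BJ; apply: dBe; apply: indep_sub iJ _ => y [By|->].
      by apply: contrapT => nJy; apply: BJ; exists y.
    exact: CJ.
  have BxK : B `\ x `|` [set x] `<=` B by move=> y [[]|->].
  have [|||y [Jy nBxy] iBxy] := @basis_augment _ (B `\ x) _ x bJ _ _ _ (indep_sub iB BxK).
  - by left.
  - by move=> [_ /(_ erefl)].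
  - by move=> y [By _]; left.
  have nyx : y <> x by move=> yx; apply: nJx; rewrite -yx.
  have {Jy} ye : y = e by case: (JBe y Jy) => // By; case: nBxy.
  apply/nJx/CJ; split; first by left.
  rewrite {}ye in iBxy; apply: indep_sub iBxy _ => u [[Bu|->] nux]; first by left.
  by right.
apply/seteqP; split=> // x [Bex iBex]; apply: contrapT => nDx; apply: dD.
apply: indep_sub iBex _ => y Dy; split; first exact: (DC y Dy).1.
by move=> yx; apply: nDx; rewrite -yx.
Qed.

Lemma indep_circuit I C : indep M I -> circuit M C -> ~ C `<=` I.
Proof. by move=> iI [dC _] CI; apply/dC/indep_sub/CI. Qed.

(** Descent through infinite dependent sets need not stop; a fundamental circuit over a basis of [D]
    gives a minimal one directly. *)
Lemma dep_circuit D : ~ indep M D -> exists2 C, circuit M C & C `<=` D.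
Proof.
move=> dD; have [B bB _] := indep_extend (@indep_set0 _ M) (@sub0set _ D).
have [[iB BD] _] := bB.
have [e De nBe] : exists2 e, D e & ~ B e.
  apply: contrapT => DB; apply: dD; apply: indep_sub iB _ => y Dy.
  by apply: contrapT => nBy; apply: DB; exists y.
have [C [cC _ CB]] := fundamental_circuit iB (basis_notin bB De nBe).
exists C => // y Cy; have [->//|ye] := pselect (y = e).
by apply/BD/CB.
Qed.

Lemma mspan_mono X Y : X `<=` Y -> mspan M X `<=` mspan M Y.
Proof.
move=> XY x [/XY|[C [cC Cx CX]]]; [by left|right].
by exists C; split=> // y /CX/XY.
Qed.

Lemma mspan_dep I x : indep M I -> mspan M I x -> ~ I x -> ~ indep M (I `|` [set x]).
Proof.
move=> iI [//|[C [cC Cx CI]]] _ iIx; apply: (indep_circuit iIx cC) => y Cy.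
by have [->|yx] := pselect (y = x); [right|left; apply: CI].
Qed.

Lemma dep_mspan I x : indep M I -> ~ indep M (I `|` [set x]) -> mspan M I x.
Proof. by move=> iI /(fundamental_circuit iI) Hx; right. Qed.

Lemma mspan_idem I : indep M I -> mspan M (mspan M I) `<=` mspan M I.
Proof.
move=> iI x [//|[C [cC Cx CI]]]; apply: contrapT => nx.
have iIx : indep M (I `|` [set x]).
  by apply: contrapT => /(dep_mspan iI).
have iCx : indep M (C `\ x).
  apply: contrapT => dCx.
  have : C `\ x = C by apply: cC.2 => // y [].
  by move=> CxC; have := Cx; rewrite -CxC => -[_ /(_ erefl)].
have [J bJ CJ] := indep_extend iCx CI.
have [[iJ JI] Jmax] := bJ.
(* [J] plus [x] contains the circuit [C], so [J] stays maximal. Since [x] augments [I], some element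
   of [J] must too, yet [I] spans all of [J]. *)
have bJ' : basis (mspan M I `|` [set x]) J.
  apply: basisI => // [y /JI|y []]; [by left| exact: basis_notin|].
  move=> -> nJx iJx; apply: (indep_circuit iJx cC) => z Cz.
  by have [->|zx] := pselect (z = x); [right|left; apply: CJ].
have [|||e [Je nIe] iIe] := @basis_augment _ I _ x bJ' _ _ _ iIx.
- by right.
- by move=> Ix; apply: nx; left.
- by move=> y Iy; left; left.
exact: mspan_dep iI (JI _ Je) nIe iIe.
Qed.

Lemma indep_not_mspan I X x : indep M I -> I x -> X `<=` I -> ~ X x -> ~ mspan M X x.
Proof.
move=> iI Ix XI nXx [//|[C [cC Cx CX]]]; apply: (indep_circuit iI cC) => y Cy.
by have [->//|yx] := pselect (y = x); apply/XI/CX.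
Qed.

End MatroidTheory.

(** * Strict well-orders with a prescribed initial segment *)

Definition strict_well_order (E : Type) (lt : E -> E -> Prop) : Prop :=
  [/\ forall x y z, lt x y -> lt y z -> lt x z,
      forall x y, x <> y -> lt x y \/ lt y x &
      forall S : set E, S !=set0 -> exists2 m, S m & forall x, S x -> ~ lt x m].

Lemma strict_well_order_irr E (lt : E -> E -> Prop) x :
  strict_well_order lt -> ~ lt x x.
Proof. by move=> [_ _ /(_ [set x])[|_ -> /(_ x erefl)]//]; exists x. Qed.

(** Consider the minimum of the three elements: unless it is [x], antisymmetry identifies two of
    them. *)
Lemma wo_transitive (T : eqType) (R : rel T) : wochoice.well_order R -> transitive R.
Proof.
move=> Rwo y x z Rxy Ryz.
have chT : wochoice.wo_chain R predT by move=> A _; apply: Rwo.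
have Ranti a b : R a b -> R b a -> a = b.
  by move=> Rab Rba; apply: (wochoice.wo_chain_antisymmetric chT) => //; apply/andP.
have [|m [[+ mmin] _]] := Rwo (mem [:: x; y; z]).
  by exists x; rewrite !inE eqxx.
have [mx my mz] : [/\ R m x, R m y & R m z] by split; apply: mmin; rewrite !inE eqxx ?orbT.
rewrite !inE => /or3P[] /eqP ?; subst m => //.
  by rewrite (Ranti x y).
by rewrite -(Ranti y z).
Qed.

Lemma strict_well_order_initial E (A : set E) :
  exists2 lt, strict_well_order lt & forall x y, A x -> lt y x -> A y.
Proof.
have [R Rwo] := wochoice.well_ordering_principle {classic E}.
have chT : wochoice.wo_chain R predT by move=> S _; apply: Rwo.
have Ranti a b : R a b -> R b a -> a = b.
  by move=> Rab Rba; apply: (wochoice.wo_chain_antisymmetric chT) => //; apply/andP.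
have Rtot a b : R a b || R b a by apply: (wochoice.wo_chainW chT).
have Rtr := wo_transitive Rwo.
(* [A] is placed before its complement and each keeps the order [R]; by totality [~ R y x] expresses
   strict precedence. *)
exists (fun x y => (A x /\ ~ A y) \/ ((A x <-> A y) /\ ~ R y x)); last first.
  by move=> x y Ax [[]|[yx _]]//; apply/yx.
split.
- move=> x y z [[Ax nAy]|[Axy nyx]] [[Ay nAz]|[Ayz nzy]]; try by left; tauto.
  right; split; [tauto|move=> Rzx; apply: nyx].
  by have /orP[/Rtr->|/nzy] := Rtot y z.
- move=> x y nxy.
  have [Ax|nAx] := pselect (A x); have [Ay|nAy] := pselect (A y); try tauto.
  + have [Ryx|nRyx] := pselect (R y x); last by left; right.
    by right; right; split=> // /Ranti/(_ Ryx).
  + have [Ryx|nRyx] := pselect (R y x); last by left; right.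
    by right; right; split=> // /Ranti/(_ Ryx).
- move=> S [s Ss].
  have min (P : set E) : P !=set0 -> exists2 m, P m & forall x, P x -> R m x.
    move=> [p Pp]; have [|m [[/asboolP Pm mP] _]] := Rwo (fun x => `[<P x>]).
      by exists p; apply/asboolP.
    by exists m => // x Px; apply/mP/asboolP.
  have [SA|SA] := pselect (S `&` A !=set0).
    have [m [Sm Am] mmin] := min _ SA; exists m => // x Sx [[]//|[xm]].
    by apply; apply: mmin; split=> //; apply/xm.
  have nA x : S x -> ~ A x by move=> Sx Ax; apply: SA; exists x.
  have [|m Sm mmin] := min S; first by exists s.
  by exists m => // x Sx [[Ax _]|[_]]; [apply: nA Ax|apply; apply: mmin].
Qed.

Lemma finite_set_max E (lt : E -> E -> Prop) (C : set E) :
  strict_well_order lt -> finite_set C -> C !=set0 ->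
  exists2 m, C m & forall x, C x -> x <> m -> lt x m.
Proof.
move=> [lt_tr lt_tot _] finC; have /finite_seqP[s Cs] := (finC : @finite_set {classic E} C).
rewrite {}Cs {finC C}; elim: s => [|a s IHs] [x //= sx].
have [s0|/nilP] := pselect (s = [::]).
  by subst s; exists a => [|y]; rewrite /= ?inE // => /eqP.
case: s IHs {sx} => // b s IHs _.
have [|m sm mmax] := IHs; first by exists b; rewrite /= mem_head.
have [eam|nam] := pselect (a = m).
  exists m => [|y]; rewrite /= in_cons ?eam ?eqxx // => /orP[/eqP->//|ys].
  exact: mmax.
have [am|ma] := lt_tot _ _ nam.
  exists m => [|y]; rewrite /= in_cons ?sm ?orbT// => /orP[/eqP->//|ys].
  exact: mmax.
exists a => [|y]; rewrite /= in_cons ?eqxx // => /orP[/eqP->//|ys] _.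
have [->//|ym] := pselect (y = m).
by apply: lt_tr ma; apply: mmax.
Qed.

(** * Rejection along a well-order *)

Definition rejected {E : Type} (M : matroid E) (lt : E -> E -> Prop) (X : set E) : set E :=
  [set x | X x /\ mspan M [set y | X y /\ lt y x] x].

Section Rejected.
Context {E : Type} (M : matroid E) (lt : E -> E -> Prop).
Hypothesis lt_wo : strict_well_order lt.

(** Spanning is tested against all predecessors in the set, not just the accepted ones; this is what
    makes rejection monotone. *)
Lemma rejected_mono X Y : X `<=` Y -> rejected M lt X `<=` rejected M lt Y.
Proof.
move=> XY x [Xx sx]; split; first exact: XY.
by apply: mspan_mono sx => y [Xy]; split=> //; apply: XY.
Qed.

(* The largest element of a circuit in [X] is rejected from [X]; finiteness of
circuits provides this largest element. *)
Lemma indep_accepted X : finitary M -> indep M (X `\` rejected M lt X).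
Proof.
move=> finM; apply: contrapT => /dep_circuit[C cC CX].
have C0 : C !=set0.
  apply: contrapT => C0; apply: (indep_circuit (@indep_set0 _ M) cC) => x Cx.
  by apply: C0; exists x.
have [m Cm mmax] := finite_set_max lt_wo (finM _ cC) C0.
have [Xm] := CX _ Cm; apply; split=> //; right; exists C; split=> // y [Cy ym].
by split; [exact: (CX _ Cy).1|apply: mmax].
Qed.

(** A least counterexample would be rejected, hence spanned by predecessors that the accepted
    elements already span; idempotence of span concludes. *)
Lemma mspan_accepted X : finitary M -> X `<=` mspan M (X `\` rejected M lt X).
Proof.
move=> finM x0 Xx0; apply: contrapT => nx0.
have [_ _ /(_ [set x | X x /\ ~ mspan M (X `\` rejected M lt X) x])] := lt_wo.
case; first by exists x0.
move=> x [Xx nx] xmin; have [[_ sx]|nrx] := pselect (rejected M lt X x); last first.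
  by apply: nx; left.
apply: nx; apply: mspan_idem; first exact: indep_accepted.
apply: mspan_mono sx => y [Xy yx].
by apply: contrapT => ny; apply: (xmin y).
Qed.

(** The predecessors of an element of [I] are other elements of [I], which cannot span it by
    independence. *)
Lemma initial_not_rejected I X : (forall x y, I x -> lt y x -> I y) ->
  indep M I -> I `<=` ~` rejected M lt X.
Proof.
move=> Iinit iI x Ix [_]; apply: (indep_not_mspan iI Ix) => [y [_ /(Iinit _ _ Ix)]//|].
by move=> [_]; apply: strict_well_order_irr.
Qed.

End Rejected.

(** The union of all [S] contained in [f S] is the largest fixed point. *)
Lemma tarski_fixpoint (E : Type) (f : set E -> set E) :
  (forall X Y, X `<=` Y -> f X `<=` f Y) -> exists A, f A = A.
Proof.
move=> f_mono; pose A := \bigcup_(S in [set S | S `<=` f S]) S.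
have AfA : A `<=` f A.
  move=> x [S SfS /SfS]; apply: f_mono => y Sy; by exists S.
by exists A; apply/seteqP; split=> // x fAx; exists (f A) => //; apply: f_mono.
Qed.

Unset Implicit Arguments.

Theorem theorem1p5 (E : Type) (M0 M1 : matroid E)
    (finM0 : finitary M0) (finM1 : finitary M1) (I0 I1 : set E)
    (hI0 : (indep M0 `&` indep M1) I0) (hI1 : (indep M0 `&` indep M1) I1) :
  exists2 I : set E, (indep M0 `&` indep M1) I &
    I0 `<=` mspan M0 I /\ I1 `<=` mspan M1 I.
Proof.
have [lt0 lt0_wo I1_init] := strict_well_order_initial I1.
have [lt1 lt1_wo I0_init] := strict_well_order_initial I0.
(* The two complements each reverse inclusion, so the composite is monotone. With [B] defined from
   [A], the fixed-point equation [eqA] is the second of the two complement relations. *)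
have [X Y XY|A] := @tarski_fixpoint E
  (fun S => ~` rejected M1 lt1 (~` rejected M0 lt0 S)).
  by apply/subsetC/rejected_mono/subsetC/rejected_mono.
set B := ~` rejected M0 lt0 A => eqA.
have accepted0 : A `\` rejected M0 lt0 A = A `&` B by rewrite setDE.
have accepted1 : B `\` rejected M1 lt1 B = A `&` B by rewrite setDE eqA setIC.
exists (A `&` B).
  split; first by rewrite -accepted0; apply: indep_accepted.
  by rewrite -accepted1; apply: indep_accepted.
split.
  rewrite -accepted0; apply: (subset_trans _ (mspan_accepted lt0_wo finM0)).
  by rewrite -[X in _ `<=` X]eqA; apply: (initial_not_rejected lt1_wo I0_init hI0.2).
rewrite -accepted1; apply: (subset_trans _ (mspan_accepted lt1_wo finM1)).
exact: (initial_not_rejected lt0_wo I1_init hI1.1).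
Qed.
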